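(* Let $K\subseteq\mathbf{R}^n$ be a nonempty closed set and let $f=(f_1,\dots,f_s):\mathbf{R}^n\to\mathbf{R}^s$ be a vector polynomial with $\deg f_i=d_i\ge 1$ for $i=1,\dots,s$. If $SOL^{w}(K_\infty,f^\infty)=\{0\}$, then $SOL^{s}(K,f)$ is nonempty and $SOL^{w}(K,f)$ is compact.
   Context: $\mathbf{R}^s_+$ is the nonnegative orthant. For a nonempty closed set $C\subseteq\mathbf{R}^n$ and a vector polynomial $h:\mathbf{R}^n\to\mathbf{R}^s$, $SOL^{s}(C,h)$ (Pareto efficient solutions) is the set of $x^*\in C$ such that $h(x)-h(x^* )\notin-\mathbf{R}^s_+\setminus\{0\}$ for all $x\in C$, and $SOL^{w}(C,h)$ (weak Pareto efficient solutions) is the set of $x^*\in C$ such that $h(x)-h(x^* )\notin-\mathrm{int}\,\mathbf{R}^s_+$ for all $x\in C$. The asymptotic cone of $K$ is $K_\infty=\{v\in\mathbf{R}^n:\text{ there exist } t_k\to+\infty \text{ and } x_k\in K \text{ with } x_k/t_k\to v\}$. For a vector polynomial $p=(p_1,\dots,p_s)$ with $\deg p_i=d_i$, $p^\infty=(p_1^\infty,\dots,p_s^\infty)$ where $p_i^\infty(x)=\lim_{\lambda\to+\infty}p_i(\lambda x)/\lambda^{d_i}$. *)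

(* Defs.v *)
From HB Require Import structures.
From mathcomp Require Import all_boot all_order all_algebra.
From mathcomp Require Import all_classical all_reals all_analysis.
(* The notations of [mpoly] clash with those of MathComp-Analysis. *)
From mathcomp Require Import -(notations) mpoly.

Set Implicit Arguments.
Unset Strict Implicit.
Unset Printing Implicit Defensive.

Import Order.TTheory GRing.Theory Num.Theory.
Import numFieldNormedType.Exports.

Local Open Scope classical_set_scope.
Local Open Scope ring_scope.

Definition orthant (R : realType) (s : nat) : set 'rV[R]_s :=
  [set y | forall i, 0 <= y ord0 i].
Arguments orthant R s : clear implicits.

Definition pareto_sol (R : realType) (n s : nat)
    (C : set 'rV[R]_n) (h : 'rV[R]_n -> 'rV[R]_s) : set 'rV[R]_n :=
  [set x' | C x' /\ forall x, C x ->
     ~ ((-%R @` orthant R s) `\` [set 0]) (h x - h x')].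

Definition weak_pareto_sol (R : realType) (n s : nat)
    (C : set 'rV[R]_n) (h : 'rV[R]_n -> 'rV[R]_s) : set 'rV[R]_n :=
  [set x' | C x' /\ forall x, C x ->
     ~ (-%R @` (orthant R s)°) (h x - h x')].

Definition asymptotic_cone (R : realType) (n : nat) (K : set 'rV[R]_n) :
    set 'rV[R]_n :=
  [set v | exists (t : nat -> R) (x : nat -> 'rV[R]_n),
     [/\ t @ \oo --> +oo, forall k, K (x k)
       & (t k)^-1 *: x k @[k --> \oo] --> v]].

(* [mmeasure mdeg p] is [msize p], which is one more than the degree of a
   nonzero [p] and 0 for [p = 0]; the zero polynomial thus gets degree 0. *)
Definition mpdegree (R : realType) (n : nat) (p : mpoly n R) : nat :=
  (mmeasure mdeg p).-1.

Definition mpeval (R : realType) (n : nat) (p : mpoly n R) (x : 'rV[R]_n) : R :=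
  meval (x ord0) p.

Definition mpeval_infty (R : realType) (n : nat) (p : mpoly n R)
    (x : 'rV[R]_n) : R :=
  lim (mpeval p (l *: x) / l ^+ mpdegree p @[l --> +oo]).

Definition vpoly (R : realType) (n s : nat) (f : 'I_s -> mpoly n R)
    (x : 'rV[R]_n) : 'rV[R]_s :=
  \row_i mpeval (f i) x.

Definition vpoly_infty (R : realType) (n s : nat) (f : 'I_s -> mpoly n R)
    (x : 'rV[R]_n) : 'rV[R]_s :=
  \row_i mpeval_infty (f i) x.

(* Main.v *)
(* Let F_i(x, u) be the homogenization of f_i, so that f_i = F_i(., 1) and the
   leading form of f_i is F_i(., 0). If all f_i (or all leading forms) are
   bounded above on an unbounded set A, then rescaling to the unit sphere gives
   v != 0 in the asymptotic cone of A with F_i(v, 0) <= 0 for all i.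
   Since 0 is weakly efficient for f^oo on K_oo, a nonzero v in K_oo with
   f^oo(v) <= 0 would be weakly efficient too; hence there is none, and the
   sublevel sets of f^oo on K_oo are compact. So each v in K_oo lies above an
   efficient point, which is 0, that is f^oo(v) >= 0. A nonzero v with
   f_i^oo(v) <= 0 for a single i would then be weakly efficient; thus every
   f_i^oo is positive on K_oo minus 0, and every single f_i is coercive on K.
   Efficient points are obtained by minimising the sum of the f_i over a
   (compact) sublevel set, and a weakly efficient point x satisfies
   f_i(x) <= f_i(x0) for some i, x0 being any fixed point of K. *)
Require Import Defs.
From mathcomp Require Import all_boot all_order all_algebra.
From mathcomp Require Import all_classical all_reals all_analysis.
From mathcomp Require Import -(notations) mpoly.

Set Implicit Arguments.
Unset Strict Implicit.
Unset Printing Implicit Defensive.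

Import Order.TTheory GRing.Theory Num.Theory.
Import numFieldNormedType.Exports.
Local Open Scope classical_set_scope.
Local Open Scope ring_scope.

(** * Homogenization: a polynomial and its leading form in one function *)

Section Homogenization.
Variables (R : realType) (n : nat) (p : mpoly n R).

(** Keeping [u] as a variable turns limits at infinity into joint continuity at [u = 0]. *)
Definition homogenize (x : 'rV[R]_n) (u : R) : R :=
  \sum_(m <- msupp p)
    mcoeff m p * \prod_(i < n) x ord0 i ^+ m i * u ^+ (mpdegree p - mdeg m).

Lemma homogenize1 x : homogenize x 1 = mpeval p x.
Proof.
by rewrite /mpeval mevalE; apply: eq_bigr => m _; rewrite expr1n mulr1.
Qed.

Lemma homogenizeZ l x u :
  homogenize (l *: x) (l * u) = l ^+ mpdegree p * homogenize x u.
Proof.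
rewrite /homogenize mulr_sumr big_seq [RHS]big_seq; apply: eq_bigr => m msp.
(* On the support, the natural subtraction [mpdegree p - mdeg m] never truncates. *)
have le_md : (mdeg m <= mpdegree p)%N.
  have := msize_mdeg_lt msp; rewrite /mpdegree.
  by case: (mmeasure mdeg p).
rewrite (eq_bigr (fun i => l ^+ m i * x ord0 i ^+ m i)); last first.
  by move=> i _; rewrite mxE exprMn.
rewrite big_split/= prodrXr -mdegE exprMn.
have -> : l ^+ mpdegree p = l ^+ (mpdegree p - mdeg m) * l ^+ mdeg m.
  by rewrite -exprD subnK.
by rewrite [mcoeff m p * _]mulrCA mulrACA [l ^+ mdeg m * _]mulrC.
Qed.

Lemma homogenize_cvg (T : Type) (F : set_system T) (g : T -> 'rV[R]_n)
    (h : T -> R) (x : 'rV[R]_n) (u : R) : Filter F -> g @ F --> x -> h @ F --> u ->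
  homogenize (g t) (h t) @[t --> F] --> homogenize x u.
Proof.
move=> FF gx hu; apply: cvg_big => [|m _]; first exact: add_continuous.
apply: cvgM; last exact: (cvg_comp _ _ hu (@exprn_continuous _ _ _)).
apply: cvgM; first exact: cvg_cst.
apply: cvg_big => [|i _]; first exact: mul_continuous.
apply: (@continuous_cvg _ _ _ _ _ (fun t => g t ord0 i) (fun y => y ^+ m i)).
  exact: exprn_continuous.
apply: (@continuous_cvg _ _ _ _ _ g (fun y : 'rV[R]_n => y ord0 i)) => //.
exact: coord_continuous.
Qed.

Lemma homogenize_continuousl u : continuous (homogenize^~ u).
Proof.
move=> x; apply: (@homogenize_cvg _ (nbhs x) id (fun=> u) x u) => //.
exact: cvg_cst.
Qed.

(** By homogeneity the quotient under the limit equals [homogenize x l^-1] for [l > 0], and [l^-1]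
    tends to 0. *)
Lemma mpeval_inftyE x : mpeval_infty p x = homogenize x 0.
Proof.
apply: cvg_lim => //.
apply: (@cvg_trans _ (homogenize x l^-1 @[l --> +oo])).
  apply: near_eq_cvg; near=> l.
  have l0 : 0 < l by near: l; exact: nbhs_pinfty_gt.
  rewrite -homogenize1 -(divff (lt0r_neq0 l0)) homogenizeZ mulrC mulKf//.
  by rewrite expf_neq0// gt_eqF.
apply: (@homogenize_cvg _ _ (fun=> x) GRing.inv x 0) => //; first exact: cvg_cst.
apply/gtr0_cvgV0; last exact: cvg_id.
exact: nbhs_pinfty_gt.
Unshelve. all: by end_near. Qed.

End Homogenization.

(** * Asymptotic cones and directions of unboundedness *)

Section AsymptoticCone.
Variables (R : realType) (n : nat).
Implicit Types (A K : set 'rV[R]_n) (v x : 'rV[R]_n).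

(** Trades sequences for single approximants, so that closedness and idempotence become [e / 2]
    arguments. *)
Lemma asymptotic_coneP K v :
  asymptotic_cone K v <->
  forall e T : R, 0 < e ->
    exists t x, [/\ T < t, K x & `|v - t^-1 *: x| < e].
Proof.
split=> [[t [x [toy Kx xv]]] e T e0|H].
  have : \forall k \near \oo, T < t k /\ `|v - (t k)^-1 *: x k| < e.
    near=> k; split; near: k; first by move/cvgryPgt : toy; exact.
    by move/cvgrPdist_lt : xv; exact.
  by move=> [N _ /(_ N (leqnn N))[Tt xe]]; exists (t N), (x N).
have /choice[tx txP] : forall k : nat, exists z : R * 'rV[R]_n,
    [/\ k%:R < z.1, K z.2 & `|v - z.1^-1 *: z.2| < k.+1%:R^-1].
  move=> k; have [|t [x [? ? ?]]] := H k.+1%:R^-1 k%:R; first by rewrite invr_gt0.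
  by exists (t, x).
exists (fun k => (tx k).1), (fun k => (tx k).2); split.
- apply/cvgryPgt => M; near=> k; have [+ _ _] := txP k; apply: le_lt_trans.
  by near: k; exact: nbhs_infty_ger.
- by move=> k; have [] := txP k.
- apply/cvgrPdist_lt => e e0; near=> k; have [_ _] := txP k; move=> /lt_trans; apply.
  by near: k; exact: near_infty_natSinv_lt (PosNum e0).
Unshelve. all: by end_near. Qed.

Lemma asymptotic_cone_closed K : closed (asymptotic_cone K).
Proof.
move=> v clv; apply/asymptotic_coneP => e T e0.
have e20 : 0 < e / 2 by rewrite divr_gt0.
have [w [/asymptotic_coneP/(_ (e / 2) T e20)[t [x [Tt Kx wx]]]]] :=
  clv _ (nbhsx_ballx v _ e20).
rewrite -ball_normE/= => vw; exists t, x; split => //.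
by rewrite (splitr e) (le_lt_trans (ler_distD w _ _))// ltrD.
Qed.

Lemma asymptotic_cone_idem K :
  asymptotic_cone (asymptotic_cone K) `<=` asymptotic_cone K.
Proof.
move=> v /asymptotic_coneP H; apply/asymptotic_coneP => e T e0.
have e20 : 0 < e / 2 by rewrite divr_gt0.
(* The error made on [w] gets divided by [t], so [1 < t] keeps it below [e / 2]; with [T < t'] it
   also gives [T < t * t']. *)
have [t [w [Tt Kw vw]]] := H (e / 2) (Num.max 1 T) e20.
have [t1 Tt'] : 1 < t /\ T < t by move: Tt; rewrite gt_max => /andP.
have [t' [x [T1 Kx wx]]] := (asymptotic_coneP _ _).1 Kw (e / 2) (Num.max 1 T) e20.
have [t'1 Tt1] : 1 < t' /\ T < t' by move: T1; rewrite gt_max => /andP.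
have t0 : 0 < t by rewrite (lt_trans _ t1).
exists (t * t'), x; split => //.
  rewrite (lt_trans Tt1)// -[ltLHS]mul1r ltr_pM2r// (lt_trans _ t'1)//.
rewrite (splitr e) (le_lt_trans (ler_distD (t^-1 *: w) _ _))// ltrD//.
rewrite invfM -scalerA -scalerBr normrZ ger0_norm ?invr_ge0 ?(ltW t0)//.
by rewrite (le_lt_trans _ wx)// ler_piMl// invf_le1// ltW.
Qed.

Lemma asymptotic_coneS A K :
  A `<=` K -> asymptotic_cone A `<=` asymptotic_cone K.
Proof.
by move=> AK v [t [x [? Ax ?]]]; exists t, x; split => // k; exact/AK/Ax.
Qed.

(** Compactness of the unit sphere gives a cluster point of normalized points of [A]. The scale is
    [|x|] itself, the factor by which polynomials are rescaled later. *)
Lemma unbounded_direction A : ~ bounded_set A ->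
  exists v, `|v| = 1 /\ forall e T : R, 0 < e ->
    exists x, [/\ T < `|x|, A x & `|v - `|x|^-1 *: x| < e].
Proof.
move=> unbA.
have /choice[x xP] : forall k : nat, exists x, A x /\ k.+1%:R < `|x|.
  move=> k; apply: contrapT => bA; apply: unbA; exists k.+1%:R.
  split=> [|M kM x Ax]; first exact: num_real.
  apply: le_trans (ltW kM); rewrite leNgt; apply/negP => kx.
  by apply: bA; exists x.
have x0 k : 0 < `|x k| by apply: lt_trans (xP k).2.
pose S : set 'rV[R]_n := [set v | `|v| = 1].
have cS : compact S.
  apply: bounded_closed_compact.
    exists 1; split=> [|M M1 v /= ->]; first exact: num_real.
    exact: ltW.
  have -> : S = Num.norm @^-1` [set 1] by [].
  by apply: closed_comp; [move=> ? _; exact: norm_continuous|exact: closed_eq].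
pose u k := `|x k|^-1 *: x k.
have uS : (u @ \oo) S.
  exists 0 => // k _; rewrite /S/= normrZ ger0_norm ?invr_ge0// mulVf//.
  by rewrite gt_eqF.
have [v [v1 clv]] := cS _ _ uS.
exists v; split=> // e T e0.
have [|_ [[k /= kT <-]]] := clv [set u k | k in [set k | T < k.+1%:R]] _ _
  (nbhsx_ballx v _ e0).
  have [N _ NP] := nbhs_infty_gtr T.
  exists N => // k /= Nk; exists k => //=.
  by rewrite (lt_trans (NP _ Nk))// ltr_nat.
rewrite -ball_normE/= => vu; exists (x k).
by split=> //; [exact: lt_trans kT (xP k).2|exact: (xP k).1].
Qed.

End AsymptoticCone.

(* Taking [a := 1] treats [p], and [a := 0] treats its leading form. *)
Lemma unbounded_sublevel (R : realType) (n : nat) (I : Type)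
    (p : I -> mpoly n R) (a : R) (M : I -> R) (A : set 'rV[R]_n) :
  (forall i, 1 <= mpdegree (p i))%N ->
  (forall i x, A x -> homogenize (p i) x a <= M i) ->
  ~ bounded_set A ->
  exists v, [/\ v != 0, asymptotic_cone A v
              & forall i, homogenize (p i) v 0 <= 0].
Proof.
move=> d1 AM /unbounded_direction[v [v1 vP]]; exists v; split.
- by rewrite -normr_eq0 v1 oner_eq0.
- apply/asymptotic_coneP => e T /vP -/(_ T)[x [? ? ?]].
  by exists `|x|, x.
move=> i; rewrite leNgt; apply/negP => p0.
set c := homogenize (p i) v 0 in p0.
have c20 : 0 < c / 2 by rewrite divr_gt0.
have : \forall z \near (v, 0 : R), c / 2 < homogenize (p i) z.1 z.2.
  have pc : homogenize (p i) z.1 z.2 @[z --> (v, 0 : R)] --> c.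
    by apply: homogenize_cvg; [exact: cvg_fst|exact: cvg_snd].
  apply: (cvgr_gt _ pc).
  by rewrite /= ltr_pdivrMr// ltr_pMr// ltr1n.
move=> /nbhs_ballP[e /= e0 eP].
(* The three bounds give, in turn, [|x| <= |x| ^+ d] for the degree [d >= 1], [|a| / |x| < e], and
   [M i < |x| * (c / 2)]. *)
have [x [xT Ax vx]] := vP e (Num.max 1 (Num.max (`|a| / e) (M i / (c / 2)))) e0.
move: xT; rewrite !gt_max => /and3P[x1 xa xM].
have x0 : 0 < `|x| by rewrite (lt_trans _ x1).
have := AM i x Ax.
have -> : homogenize (p i) x a =
    `|x| ^+ mpdegree (p i) * homogenize (p i) (`|x|^-1 *: x) (`|x|^-1 * a).
  by rewrite -homogenizeZ scalerA mulrA divff ?gt_eqF// scale1r mul1r.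
have : c / 2 < homogenize (p i) (`|x|^-1 *: x) (`|x|^-1 * a).
  apply: (eP (_, _)); split => /=; first by rewrite -ball_normE.
  rewrite -ball_normE/= sub0r normrN normrM ger0_norm ?invr_ge0//.
  by rewrite mulrC ltr_pdivrMr// mulrC -ltr_pdivrMr.
move=> ch; apply/negP; rewrite -ltNge.
apply: (@lt_le_trans _ _ (`|x| * (c / 2))); first by rewrite -ltr_pdivrMr.
apply: ler_pM; [exact: ltW|exact: ltW| |exact: ltW].
by rewrite -[leLHS]expr1 ler_weXn2l// ltW.
Qed.

(** * Efficient and weakly efficient points *)

Section Pareto.
Variables (R : realType) (n s : nat).
Implicit Types (C : set 'rV[R]_n) (h : 'rV[R]_n -> 'rV[R]_s).

Lemma interior_orthant (y : 'rV[R]_s) :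
  (orthant R s)° y <-> forall i, 0 < y ord0 i.
Proof.
split=> [/nbhs_ballP[e /= e0 ey] i|y0].
  have e20 : 0 < e / 2 by rewrite divr_gt0.
  have /(_ i) : orthant R s (y - const_mx (e / 2)).
    apply: ey; split; first exact: e0.
    move=> j k; rewrite !mxE -ball_normE/= opprB addrC subrK ger0_norm ?ltW//.
    by rewrite ltr_pdivrMr// ltr_pMr// ltr1n.
  by rewrite !mxE subr_ge0; exact: lt_le_trans.
have : nbhs y [set z : 'rV[R]_s | forall i, 0 < z ord0 i].
  apply: (@filter_forall _ _ (fun i (z : 'rV[R]_s) => 0 < z ord0 i) (nbhs y)) => i.
  have yi : z ord0 i @[z --> y] --> y ord0 i by exact: coord_continuous.
  exact: (cvgr_gt _ yi).
by apply: filterS => z z0 i; exact/ltW/z0.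
Qed.

Lemma weak_pareto_solP C h x' :
  weak_pareto_sol C h x' <->
  C x' /\ forall x, C x -> exists i, h x' ord0 i <= h x ord0 i.
Proof.
split=> -[Cx' H]; split=> // x /H.
  move=> nd; apply: contrapT => nle; apply: nd.
  exists (h x' - h x); last by rewrite opprB.
  apply/interior_orthant => i; rewrite !mxE subr_gt0 ltNge.
  by apply/negP => hi; apply: nle; exists i.
move=> [i hi] [y /interior_orthant/(_ i) y0 yE].
move: hi; rewrite -subr_ge0.
have -> : h x ord0 i - h x' ord0 i = - y ord0 i.
  by have /matrixP/(_ ord0 i) := yE; rewrite !mxE.
by rewrite oppr_ge0 leNgt y0.
Qed.

(** For [s = 0] the interior of the orthant is the whole space, so even comparing a point with
    itself rules it out. *)
Lemma weak_pareto_sol_dim_gt0 C h x' : weak_pareto_sol C h x' -> (0 < s)%N.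
Proof.
by move=> /weak_pareto_solP[Cx' /(_ _ Cx')[i _]]; exact: leq_ltn_trans (ltn_ord i).
Qed.

Lemma pareto_sol_weak C h x' : (0 < s)%N ->
  pareto_sol C h x' -> weak_pareto_sol C h x'.
Proof.
move=> s0 [Cx' H]; apply/weak_pareto_solP; split=> // x Cx.
apply: contrapT => nle.
have hlt i : h x ord0 i < h x' ord0 i.
  by rewrite ltNge; apply/negP => hi; apply: nle; exists i.
apply: (H x Cx); split=> /=.
  exists (h x' - h x); last by rewrite opprB.
  by move=> i; rewrite !mxE subr_ge0 ltW.
move=> /matrixP/(_ ord0 (Ordinal s0)); rewrite !mxE => /eqP.
by rewrite subr_eq0 lt_eqF.
Qed.

Lemma closed_sublevel C h (a : 'rV[R]_s) :
  closed C -> (forall i, continuous (fun x => h x ord0 i)) ->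
  closed [set x | C x /\ forall i, h x ord0 i <= a ord0 i].
Proof.
move=> cC hc.
have -> : [set x | C x /\ forall i, h x ord0 i <= a ord0 i] =
    C `&` \bigcap_(i in setT) [set x | h x ord0 i <= a ord0 i].
  by apply/seteqP; split=> x [Cx H]; split=> // i; [move=> _; exact: H|exact: H].
apply: closedI => //; apply: closed_bigI => i _.
apply: (@closed_comp _ _ (fun x => h x ord0 i) [set y | y <= a ord0 i]).
  by move=> ? _; exact: hc.
exact: closed_le.
Qed.

(* A minimiser of the sum of the objectives over the sublevel set is efficient. *)
Lemma pareto_sol_below C h x0 :
  closed C -> (forall i, continuous (fun x => h x ord0 i)) -> C x0 ->
  bounded_set [set x | C x /\ forall i, h x ord0 i <= h x0 ord0 i] ->
  exists x', pareto_sol C h x' /\ forall i, h x' ord0 i <= h x0 ord0 i.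
Proof.
move=> cC hc Cx0 bS.
set S := (X in bounded_set X) in bS.
have cS : compact S.
  by apply: bounded_closed_compact => //; exact: closed_sublevel.
have S0 : S !=set0 by exists x0.
have sumc : continuous (fun x => \sum_i h x ord0 i).
  by apply: continuous_big => //; exact: add_continuous.
have [x' /set_mem[Cx' lex'] minx'] :=
  compact_EVT_min S0 cS (continuous_subspaceT sumc).
exists x'; split=> //; split=> // x Cx [[y y0 yE] neq]; apply: neq.
(* A point [x] dominating [x'] stays in the sublevel set, so minimality of the sum forces every
   difference to vanish. *)
have le i : h x ord0 i <= h x' ord0 i.
  have /matrixP/(_ ord0 i) := yE; rewrite !mxE => yi.
  by rewrite -subr_le0 -yi oppr_le0; exact: y0.
have /minx' : x \in S.
  by apply/mem_set; split=> // i; exact: le_trans (le i) (lex' i).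
rewrite -subr_le0 -sumrB => sum_le0.
have ge0 i : 0 <= h x' ord0 i - h x ord0 i by rewrite subr_ge0.
have /eqP : \sum_i (h x' ord0 i - h x ord0 i) == 0.
  by rewrite eq_le sum_le0 sumr_ge0.
move=> /psumr_eq0P /= e; apply/rowP => i; rewrite !mxE.
by apply/eqP; rewrite -oppr_eq0 opprB e.
Qed.

(** Each [x] in [C] excludes the points it strictly dominates, an open set because there are
    finitely many objectives. *)
Lemma closed_weak_pareto_sol C h :
  closed C -> (forall i, continuous (fun x => h x ord0 i)) ->
  closed (weak_pareto_sol C h).
Proof.
move=> cC hc.
have -> : weak_pareto_sol C h =
    C `&` \bigcap_(x in C) ~` [set x' | forall i, h x ord0 i < h x' ord0 i].
  apply/seteqP; split=> x'.
    move=> /weak_pareto_solP[Cx' H]; split=> // x /H[i hi] /= /(_ i).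
    by rewrite ltNge hi.
  move=> [Cx' H]; apply/weak_pareto_solP; split=> // x Cx.
  apply: contrapT => nle; apply: (H x Cx) => i /=.
  by rewrite ltNge; apply/negP => hi; apply: nle; exists i.
apply: closedI => //; apply: closed_bigI => x _; apply: open_closedC.
rewrite openE => x' /= hx'.
apply: (@filter_forall _ _ (fun i z => h x ord0 i < h z ord0 i) (nbhs x')) => i.
have hi : h z ord0 i @[z --> x'] --> h x' ord0 i by exact: hc.
exact: (cvgr_gt _ hi).
Qed.

End Pareto.

(** * Positivity of the leading forms and coercivity of each objective *)

Section LeadingForms.
Variables (R : realType) (n s : nat) (K : set 'rV[R]_n) (f : 'I_s -> mpoly n R).
Hypothesis f_ge1 : forall i, (1 <= mpdegree (f i))%N.

Lemma vpoly_inftyE x i : vpoly_infty f x ord0 i = homogenize (f i) x 0.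
Proof. by rewrite mxE mpeval_inftyE. Qed.

Lemma vpolyE x i : vpoly f x ord0 i = homogenize (f i) x 1.
Proof. by rewrite mxE homogenize1. Qed.

(** This rests on the positive degree: a nonzero constant is its own leading form. *)
Lemma homogenize00 i : homogenize (f i) 0 0 = 0.
Proof.
rewrite -[X in homogenize _ X](scale0r 0) -[X in homogenize _ _ X](mul0r 0).
by rewrite homogenizeZ expr0n gtn_eqF// mul0r.
Qed.

Hypothesis sol_infty :
  weak_pareto_sol (asymptotic_cone K) (vpoly_infty f) = [set 0].

Lemma leading_forms_ge0 v i :
  asymptotic_cone K v -> 0 <= homogenize (f i) v 0.
Proof.
move=> Kv; have s0 : (0 < s)%N := leq_ltn_trans (leq0n i) (ltn_ord i).
have /weak_pareto_solP[_ sol0] :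
    weak_pareto_sol (asymptotic_cone K) (vpoly_infty f) 0 by rewrite sol_infty.
(* The efficient point [w] below [v] is weakly efficient, hence 0, where all leading forms
   vanish. *)
have [||||w [/(pareto_sol_weak s0) + wv]] :=
    @pareto_sol_below _ _ _ (asymptotic_cone K) (vpoly_infty f) v.
- exact: asymptotic_cone_closed.
- move=> j; rewrite (_ : (fun x => _) = homogenize (f j) ^~ 0).
    exact: homogenize_continuousl.
  by apply/funext => x; rewrite vpoly_inftyE.
- exact: Kv.
- apply: contrapT => /(@unbounded_sublevel _ _ _ f 0
    (fun j => vpoly_infty f v ord0 j) _ f_ge1)[j x [_ /(_ j)]|].
    by rewrite vpoly_inftyE.
  (* Here [w] is a direction of the sublevel set; it inherits weak efficiency from 0, as its values
     are at most those at 0. *)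
  move=> w [w0 Kw fw]; move/eqP : w0; apply.
  suff : weak_pareto_sol (asymptotic_cone K) (vpoly_infty f) w by rewrite sol_infty.
  apply/weak_pareto_solP; split.
    by apply: asymptotic_cone_idem; apply: asymptotic_coneS Kw => x [].
  move=> x /sol0[j]; rewrite !vpoly_inftyE homogenize00 => fx.
  by exists j; rewrite !vpoly_inftyE (le_trans (fw j)).
- rewrite sol_infty => w0; have := wv i.
  by rewrite w0 !vpoly_inftyE homogenize00.
Qed.

Lemma leading_forms_gt0 v i :
  asymptotic_cone K v -> v != 0 -> 0 < homogenize (f i) v 0.
Proof.
move=> Kv /eqP v0.
have : ~ weak_pareto_sol (asymptotic_cone K) (vpoly_infty f) v by rewrite sol_infty.
rewrite weak_pareto_solP => nsol; rewrite ltNge; apply/negP => fv; apply: nsol.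
split=> // x Kx; exists i; rewrite !vpoly_inftyE (le_trans fv)//.
exact: leading_forms_ge0.
Qed.

Lemma bounded_poly_sublevel i c :
  bounded_set [set x | K x /\ vpoly f x ord0 i <= c].
Proof.
apply: contrapT.
(* The index type [unit] isolates the single objective [f i]. *)
move=> /(@unbounded_sublevel _ _ unit (fun=> f i) 1 (fun=> c) _ (fun=> f_ge1 i))[].
  by move=> _ x [_]; rewrite vpolyE.
move=> v [v0 Kv /(_ tt)]; rewrite leNgt leading_forms_gt0//.
by apply: asymptotic_coneS Kv => x [].
Qed.

End LeadingForms.

Unset Implicit Arguments.

Theorem theorem5p5 (R : realType) (n s : nat) (K : set 'rV[R]_n)
    (f : 'I_s -> mpoly n R) (d : 'I_s -> nat)
    (K_nonempty : K !=set0) (K_closed : closed K)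
    (deg_f : forall i, mpdegree (f i) = d i)
    (d_ge1 : forall i, (1 <= d i)%N)
    (sol_infty :
      weak_pareto_sol (asymptotic_cone K) (vpoly_infty f) = [set 0]) :
  pareto_sol K (vpoly f) !=set0 /\ compact (weak_pareto_sol K (vpoly f)).
Proof.
have f_ge1 i : (1 <= mpdegree (f i))%N by rewrite deg_f.
have fc i : continuous (fun x => vpoly f x ord0 i).
  rewrite (_ : (fun x => _) = homogenize (f i) ^~ 1).
    exact: homogenize_continuousl.
  by apply/funext => x; rewrite vpolyE.
have sublevel := bounded_poly_sublevel f_ge1 sol_infty.
have s0 : (0 < s)%N.
  apply: (@weak_pareto_sol_dim_gt0 _ _ _ (asymptotic_cone K) (vpoly_infty f) 0).
  by rewrite sol_infty.
have [x0 Kx0] := K_nonempty.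
split.
  have [//||x' [? _]] := @pareto_sol_below _ _ _ K (vpoly f) x0 K_closed fc.
    (* Bounding one objective already bounds the joint sublevel set. *)
    have [M [Mr H]] := sublevel (Ordinal s0) (vpoly f x0 ord0 (Ordinal s0)).
    by exists M; split=> // N MN x [Kx fx]; exact: (H N MN).
  by exists x'.
apply: bounded_closed_compact; last exact: closed_weak_pareto_sol.
(* The index at which a weakly efficient [x] does no worse than [x0] depends on [x]; finiteness of
   the index set gives one radius for all. *)
have bnd i : \forall M \near +oo, forall x, K x ->
    vpoly f x ord0 i <= vpoly f x0 ord0 i -> `|x| <= M.
  have [M [Mr H]] := sublevel i (vpoly f x0 ord0 i).
  by exists M; split=> // N MN x Kx fx; exact: (H N MN).
have [M [Mr H]] := filter_forall _ bnd.
exists M; split=> // N MN x /weak_pareto_solP[Kx /(_ _ Kx0)[i]].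
exact: (H N MN).
Qed.
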